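(* Let $E$ be a finite set, $\mathbb{I}=(S,(R_e)_{e\in E})$ a finite $E$-graph (the constraint graph), $\mathbb{G}$ a finite $E$-group that is compatible with $\mathbb{I}$, and $N\ge2$. Then there is a finite $E$-group $\hat{\mathbb{G}}\succeq\mathbb{G}$ (hence also compatible with $\mathbb{I}$) that is $N$-acyclic over $\mathbb{I}$ and such that every $\rho\in\mathrm{Sym}(E)$ which is simultaneously a symmetry of $\mathbb{I}$ and a symmetry of $\mathbb{G}$ is also a symmetry of $\hat{\mathbb{G}}$.
   Context: Let $E$ be a finite set. An $E$-group is a group $\mathbb{G}$ together with an inclusion $E\subseteq\mathbb{G}$ such that $E$ generates $\mathbb{G}$ and every $e\in E$ satisfies $e\neq1$, $e^2=1$. For $w=e_1\cdots e_n\in E^*$ write $[w]_{\mathbb{G}}=e_1\cdots e_n$. A homomorphism of $E$-groups is a group homomorphism fixing each $e\in E$; $\hat{\mathbb{G}}\succeq\mathbb{G}$ means such a homomorphism $\hat{\mathbb{G}}\to\mathbb{G}$ exists. An $E$-graph is a structure $\mathbb{H}=(V,(R_e)_{e\in E})$ where each $R_e\subseteq V\times V$ is symmetric and every vertex has at most one $R_e$-neighbour (loops allowed). For $e\in E$ let $\pi_e$ be the permutation of $V$ swapping each vertex with its $R_e$-neighbour if it has one and fixing it otherwise, and for $w=e_1\cdots e_n$ let $\pi_w=\pi_{e_n}\circ\cdots\circ\pi_{e_1}$. An $E$-group $\mathbb{G}$ is compatible with $\mathbb{H}$ if for every $w\in E^*$, $[w]_{\mathbb{G}}=1$ implies $\pi_w=\mathrm{id}_V$.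 For the constraint graph $\mathbb{I}=(S,(R_e))$, $\alpha\subseteq E$ and $s,t\in S$: $\alpha^*[\mathbb{I},s]$ is the set of words $w=e_1\cdots e_n\in\alpha^*$ that label a walk in $\mathbb{I}$ from $s$ (i.e. there are $s=s_0,\dots,s_n$ with $(s_{i-1},s_i)\in R_{e_i}$), and $\alpha^*[\mathbb{I},s,t]$ those labelling such a walk ending in $s_n=t$. For $g\in\mathbb{G}$ the $\mathbb{I}$-coset is $C[\mathbb{I},\alpha,s;g]:=\{g[w]_{\mathbb{G}}: w\in\alpha^*[\mathbb{I},s]\}$. An $\mathbb{I}$-coset cycle of length $n\ge2$ is a cyclically indexed family $(g_i,\alpha_i,s_i)_{i\in\mathbb{Z}_n}$ with $g_i\in\mathbb{G}$, $\alpha_i\subsetneq E$, $s_i\in S$ such that for all $i$: (connectivity) $g_{i+1}=g_i[w]_{\mathbb{G}}$ for some $w\in\alpha_i^*[\mathbb{I},s_i,s_{i+1}]$; (separation) $C[\mathbb{I},\alpha_i\cap\alpha_{i-1},s_i;g_i]\cap C[\mathbb{I},\alpha_i\cap\alpha_{i+1},s_{i+1};g_{i+1}]=\emptyset$. An $E$-group compatible with $\mathbb{I}$ is $N$-acyclic over $\mathbb{I}$ if it admits no $\mathbb{I}$-coset cycle of length $n$ with $2\le n\le N$. $\rho\in\mathrm{Sym}(E)$ is a symmetry of the $E$-group $\mathbb{G}$ if some group automorphism $\varphi$ of $\mathbb{G}$ satisfies $\varphi(e)=\rho(e)$ for all $e\in E$; it is a symmetry of the $E$-graph $\mathbb{I}$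 if there is a bijection $f:S\to S$ with $(s,t)\in R_e\Leftrightarrow(f(s),f(t))\in R_{\rho(e)}$ for all $e,s,t$. *)

(* Defs.v *)
From HB Require Import structures.
From mathcomp Require Import all_boot all_order all_fingroup.
Set Implicit Arguments. Unset Strict Implicit. Unset Printing Implicit Defensive.

Local Open Scope group_scope.

Definition is_Egraph (E V : finType) (R : E -> rel V) : Prop :=
  (forall e u v, R e u v -> R e v u) /\
  (forall e u v w, R e u v -> R e u w -> v = w).

Definition pi_e (E V : finType) (R : E -> rel V) (e : E) (v : V) : V :=
  if [pick u | R e v u] is Some u then u else v.

Definition pi_w (E V : finType) (R : E -> rel V) (w : seq E) (v : V) : V :=
  foldl (fun x e => pi_e R e x) v w.

Definition is_Egroup (E : finType) (gT : finGroupType) (iota : E -> gT) : Prop :=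
  injective iota /\
  <<[set iota e | e : E]>> = [set: gT] /\
  (forall e, iota e != 1) /\
  (forall e, iota e ^+ 2 = 1).

Definition wval (E : finType) (gT : finGroupType) (iota : E -> gT) (w : seq E) : gT :=
  \prod_(e <- w) iota e.

Definition Egroup_succeq (E : finType) (hT gT : finGroupType)
    (iotah : E -> hT) (iota : E -> gT) : Prop :=
  exists f : hT -> gT, {morph f : x y / x * y >-> x * y} /\
                       (forall e, f (iotah e) = iota e).

Definition compatible (E V : finType) (R : E -> rel V)
    (gT : finGroupType) (iota : E -> gT) : Prop :=
  forall w : seq E, wval iota w = 1 -> forall v, pi_w R w v = v.

Fixpoint walk (E S : finType) (R : E -> rel S) (s : S) (w : seq E) (t : S) : Prop :=
  match w with
  | [::] => s = t
  | e :: w' => exists s', R e s s' /\ walk R s' w' t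
  end.

Definition in_words_st (E S : finType) (R : E -> rel S) (alpha : {set E})
    (s t : S) (w : seq E) : Prop :=
  all (fun e => e \in alpha) w /\ walk R s w t.

Definition in_words_s (E S : finType) (R : E -> rel S) (alpha : {set E})
    (s : S) (w : seq E) : Prop :=
  exists t, in_words_st R alpha s t w.

Definition in_coset (E S : finType) (R : E -> rel S) (gT : finGroupType)
    (iota : E -> gT) (alpha : {set E}) (s : S) (g : gT) (x : gT) : Prop :=
  exists w, in_words_s R alpha s w /\ x = g * wval iota w.

(* An I-coset cycle of length n (indices in Z_n = 'I_n, successor ordS,
   predecessor ord_pred). *)
Definition coset_cycle (E S : finType) (R : E -> rel S) (gT : finGroupType)
    (iota : E -> gT) (n : nat)
    (g : 'I_n -> gT) (alpha : 'I_n -> {set E}) (s : 'I_n -> S) : Prop :=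
  2 <= n /\
  (forall i, alpha i \proper [set: E]) /\
  (forall i, exists w, in_words_st R (alpha i) (s i) (s (ordS i)) w /\
                       g (ordS i) = g i * wval iota w) /\
  (forall i x,
      ~ (in_coset R iota (alpha i :&: alpha (ord_pred i)) (s i) (g i) x /\
         in_coset R iota (alpha i :&: alpha (ordS i)) (s (ordS i)) (g (ordS i)) x)).

Definition N_acyclic (E S : finType) (R : E -> rel S) (gT : finGroupType)
    (iota : E -> gT) (N : nat) : Prop :=
  compatible R iota /\
  forall n, 2 <= n -> n <= N ->
    forall g alpha s, ~ @coset_cycle E S R gT iota n g alpha s.

Definition group_symmetry (E : finType) (gT : finGroupType) (iota : E -> gT)
    (rho : {perm E}) : Prop :=
  exists phi : gT -> gT, bijective phi /\
    {morph phi : x y / x * y >-> x * y} /\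
    (forall e, phi (iota e) = iota (rho e)).

Definition graph_symmetry (E S : finType) (R : E -> rel S) (rho : {perm E}) : Prop :=
  exists f : S -> S, bijective f /\
    (forall e s t, R e s t <-> R (rho e) (f s) (f t)).

(* Main.v *)
Require Import Defs.
From HB Require Import structures.
From mathcomp Require Import all_boot all_order all_fingroup.
From mathcomp Require Import boolp.
Set Implicit Arguments. Unset Strict Implicit. Unset Printing Implicit Defensive.
Local Open Scope group_scope.

(** Write [G_d] for the subgroup generated by [d].  Call [G] rich if an action of
    the letters of [d] on a set of size at most [K] times the sum of the orders of
    the [G_b], [b] a proper subset of [d], factors through [G_d] as soon as its
    restriction to each such [b] factors through [G_b].  Any [G] has a rich cover:
    level by level in [#|d|], let the generators act on all sets of bounded size
    on which they respect the subgroups of smaller levels.  No choice is made, so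
    symmetries survive.

    In a rich group, killing the letters outside [d] is a retraction onto [G_d],
    hence [G_b] and [G_d] meet in the subgroup of the intersection.  A coset cycle
    without constraints is refuted by the linear amalgam of its cosets: a
    [d]-component of it that is not a coset of [G_d] meets each coset of the chain
    in at most one coset of a proper subgroup, so it is small.

    An I-coset cycle becomes such an unconstrained cycle once one knows that an
    [a]-walk of the constraint graph whose value is [x * y], with [x] and [y] in
    the subgroups of subsets [c] and [d] of [a], has the same value as a [c]-walk
    followed by a [d]-walk.  This is read off the action on the constraint graph
    with cosets of [G_b], [b] proper in [a], attached to its [b]-components. *)

(** * Words, their values, and the subgroups generated by sets of letters *)

Section Words.
Variables (E : finType) (gT : finGroupType) (iota : E -> gT).

Definition word_in (d : {set E}) : pred (seq E) := all (fun e => e \in d).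

Definition run (V : Type) (f : E -> V -> V) (w : seq E) (v : V) : V :=
  foldl (fun x e => f e x) v w.

Definition gen (d : {set E}) : {set gT} := <<[set iota e | e in d]>>.

Definition restr (d : {set E}) (w : seq E) : seq E := [seq e <- w | e \in d].

Lemma wval_nil : wval iota [::] = 1.
Proof. by rewrite /wval big_nil. Qed.

Lemma wval_cons e w : wval iota (e :: w) = iota e * wval iota w.
Proof. by rewrite /wval big_cons. Qed.

Lemma wval_cat u w : wval iota (u ++ w) = wval iota u * wval iota w.
Proof. by rewrite /wval big_cat. Qed.

Lemma wval_rcons w e : wval iota (rcons w e) = wval iota w * iota e.
Proof. by rewrite -cats1 wval_cat wval_cons wval_nil mulg1. Qed.

Lemma word_in_sub (b d : {set E}) w : b \subset d -> word_in b w -> word_in d w.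
Proof. by move=> /subsetP bd; apply: sub_all => e; apply: bd. Qed.

Lemma word_in_cat d u w : word_in d (u ++ w) = word_in d u && word_in d w.
Proof. exact: all_cat. Qed.

Lemma word_in_rcons d w e : word_in d (rcons w e) = (e \in d) && word_in d w.
Proof. exact: all_rcons. Qed.

Lemma word_in_rev d w : word_in d (rev w) = word_in d w.
Proof. exact: all_rev. Qed.

Lemma word_inI b d w : word_in (b :&: d) w = word_in b w && word_in d w.
Proof. by rewrite /word_in -all_predI; apply: eq_all => e; rewrite /= inE. Qed.

Lemma word_inT w : word_in setT w.
Proof. by apply/allP => e _; rewrite inE. Qed.

Lemma word_in_filter d w : word_in d (restr d w).
Proof. exact: filter_all. Qed.

Lemma word_in_restr b d w : word_in b w -> word_in b (restr d w).
Proof. by move=> bw; apply/allP => e; rewrite mem_filter => /andP [_]; apply/allP. Qed.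

Lemma restr_id d w : word_in d w -> restr d w = w.
Proof. by move/all_filterP. Qed.

Lemma run_cat V (f : E -> V -> V) u w v : run f (u ++ w) v = run f w (run f u v).
Proof. exact: foldl_cat. Qed.

Lemma run_rcons V (f : E -> V -> V) w e v : run f (rcons w e) v = f e (run f w v).
Proof. by rewrite -cats1 run_cat. Qed.

Lemma run_closed (V : finType) (f : E -> V -> V) (d : {set E}) (D : {set V}) w v :
    (forall e v, e \in d -> v \in D -> f e v \in D) ->
  word_in d w -> v \in D -> run f w v \in D.
Proof.
by move=> cl; elim: w v => //= e w IH v /andP [ed wd] vD; apply: IH => //; apply: cl.
Qed.

Lemma run_revK (V : finType) (f : E -> V -> V) (d : {set E}) (D : {set V}) w v :
    (forall e v, e \in d -> v \in D -> f e v \in D) ->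
    (forall e v, e \in d -> v \in D -> f e (f e v) = v) ->
  word_in d w -> v \in D -> run f (rev w) (run f w v) = v.
Proof.
move=> cl inv; elim: w v => //= e w IH v /andP [ed wd] vD.
by rewrite rev_cons run_rcons IH ?inv //; apply: cl.
Qed.

Lemma gen_sub (b d : {set E}) : b \subset d -> gen b \subset gen d.
Proof. by move=> bd; apply: genS; apply: imsetS. Qed.

Lemma gen_iota (d : {set E}) e : e \in d -> iota e \in gen d.
Proof. by move=> ed; apply: mem_gen; apply: imset_f. Qed.

Lemma gen_one (d : {set E}) : 1 \in gen d. Proof. exact: group1. Qed.

Lemma gen_mul (d : {set E}) x y : x \in gen d -> y \in gen d -> x * y \in gen d.
Proof. exact: groupM. Qed.

Lemma gen_inv (d : {set E}) x : x \in gen d -> x^-1 \in gen d.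
Proof. by rewrite groupV. Qed.

Lemma in_gen0 x : x \in gen set0 -> x = 1.
Proof. by rewrite /gen imset0 gen0 => /set1P. Qed.

Lemma gen_setT : <<[set iota e | e : E]>> = [set: gT] -> gen setT = [set: gT].
Proof.
move=> <-; congr <<_>>; apply/setP => y.
by apply/imsetP/imsetP => -[e _ ->]; exists e.
Qed.

Lemma wval_gen d w : word_in d w -> wval iota w \in gen d.
Proof.
elim: w => [|e w IH] /=; first by rewrite wval_nil gen_one.
by case/andP=> ed wd; rewrite wval_cons gen_mul ?gen_iota ?IH.
Qed.

Hypothesis inv : forall e, iota e ^+ 2 = 1.

Lemma iotaK e : iota e * iota e = 1.
Proof. exact: inv. Qed.

Lemma iotaV e : (iota e)^-1 = iota e.
Proof. by apply/eqP; rewrite eq_invg_mul iotaK. Qed.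

Lemma wval_rev w : wval iota (rev w) = (wval iota w)^-1.
Proof.
elim: w => [|e w IH]; first by rewrite wval_nil invg1.
by rewrite rev_cons wval_rcons IH wval_cons invMg iotaV.
Qed.

Lemma gen_wordP d x : x \in gen d -> exists2 w, word_in d w & x = wval iota w.
Proof.
case/gen_prodgP=> n [c cd ->]; elim: n c cd => [|n IH] c cd.
  by exists [::] => //; rewrite wval_nil big_ord0.
have [w wd ew] := IH (fun i => c (lift ord0 i)) (fun i => cd _).
case/imsetP: (cd ord0) => e ed ee; exists (e :: w); first by rewrite /= ed.
by rewrite big_ord_recl wval_cons -ew ee.
Qed.

End Words.

Arguments word_in {E} d w.
Arguments restr {E} d w.

(** Choose a word for each element and evaluate it in [hT]. Since every relation of [iota] holds for
    [kappa], the result does not depend on the chosen word. *)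
Lemma wval_compat_hom (E : finType) (gT hT : finGroupType) (iota : E -> gT) (kappa : E -> hT) :
    <<[set iota e | e : E]>> = [set: gT] -> (forall e, iota e ^+ 2 = 1) ->
    (forall e, kappa e ^+ 2 = 1) ->
    (forall w, wval iota w = 1 -> wval kappa w = 1) ->
  exists f : gT -> hT, {morph f : x y / x * y >-> x * y} /\
     (forall w, f (wval iota w) = wval kappa w).
Proof.
move=> gG inv invk kk.
have wP x : exists w, wval iota w == x.
  have : x \in gen iota setT by rewrite gen_setT // inE.
  by case/gen_wordP => w _ ->; exists w.
have fE w : wval kappa (xchoose (wP (wval iota w))) = wval kappa w.
  have /eqP e := xchooseP (wP (wval iota w)).
  apply/eqP; rewrite eq_mulgV1 -(wval_rev invk) -wval_cat; apply/eqP/kk.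
  by rewrite wval_cat (wval_rev inv) e mulgV.
exists (fun x => wval kappa (xchoose (wP x))); split=> // x y.
have /eqP <- := xchooseP (wP x); have /eqP <- := xchooseP (wP y).
by rewrite -wval_cat !fE wval_cat.
Qed.

(** * Rich groups *)

Section Rich.
Variables (E : finType) (gT : finGroupType) (iota : E -> gT).

(** The scale of the size bounds: a union of at most [K] cosets of subgroups [gen b], [b] proper in
    [d], has at most [K * sigma d] elements. Only smaller levels enter, so a cover that keeps those
    levels does not raise it. *)
Definition sigma (d : {set E}) : nat := (\sum_(b : {set E} | b \proper d) #|gen iota b|)%N.

Definition compat_on (V : finType) (f : E -> V -> V) (D : {set V}) (d : {set E}) : Prop :=
  forall w, word_in d w -> wval iota w = 1 -> forall v, v \in D -> run f w v = v.

(** The action lives on a subset [D] of [V], so that components of a larger action can be used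
    without subtypes. The level [j] is the parameter of the inductive construction of covers. *)
Definition rich (K j : nat) : Prop :=
  forall d : {set E}, (#|d| <= j)%N ->
  forall (V : finType) (f : E -> V -> V) (D : {set V}),
    (forall e v, e \in d -> v \in D -> f e v \in D) ->
    (forall e v, e \in d -> v \in D -> f e (f e v) = v) ->
    (#|D| <= K * sigma d)%N ->
    (forall b : {set E}, b \proper d -> compat_on f D b) ->
  compat_on f D d.

Lemma gen_le_sigma (b d : {set E}) : b \proper d -> (#|gen iota b| <= sigma d)%N.
Proof. by move=> bd; rewrite /sigma (bigD1 b) //= leq_addr. Qed.

Lemma setI_properl (b d : {set E}) : ~~ (d \subset b) -> d :&: b \proper d.
Proof.
move=> db; rewrite properE subsetIl /=; apply: contra db => /subset_trans; apply.
exact: subsetIr.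
Qed.

(** A large set is handled one vertex at a time: a [d]-word stays in the small [d]-closed set [D]
    around its start, and there richness applies, its premise on proper subsets of [d] being the
    induction hypothesis. *)
Lemma rich_compat K j (V : finType) (f : E -> V -> V) (W : {set V}) :
    rich K j ->
    (forall e v, v \in W -> f e v \in W) ->
    (forall e v, v \in W -> f e (f e v) = v) ->
    (forall (d : {set E}) v, v \in W ->
      (forall w, word_in d w -> wval iota w = 1 -> run f w v = v) \/
      exists D : {set V}, [/\ D \subset W, v \in D,
        (forall e u, e \in d -> u \in D -> f e u \in D) & (#|D| <= K * sigma d)%N]) ->
  forall d : {set E}, (#|d| <= j)%N -> compat_on f W d.
Proof.
move=> rG cl inv cov d; have [n] := ubnP #|d|; elim: n d => // n IH d dn dj w wd w1 v vW.
have [/(_ w wd w1)//|[D [DW vD clD cD]]] := cov d v vW.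
have DWP := subsetP DW.
apply: (rG d dj V f D) => //; first by move=> e u _ /DWP /inv.
move=> b bd u ub u1 x /DWP; apply: (IH b) => //.
  exact: leq_trans (proper_card bd) dn.
exact: leq_trans (ltnW (proper_card bd)) dj.
Qed.

Hypothesis inv : forall e, iota e ^+ 2 = 1.

Section Retraction.
Variables (K j : nat).
Hypotheses (K0 : (0 < K)%N) (rG : rich K j).

(** Let the letters of [b] act on the group by right multiplication and all others trivially. For
    [c] inside [b] this is the regular action; otherwise a [c]-word stays in a coset of the proper
    subgroup of [c :&: b], a small closed set. *)
Lemma wval_restr (d b : {set E}) w :
  (#|d| <= j)%N -> word_in d w -> wval iota w = 1 -> wval iota (restr b w) = 1.
Proof.
move=> dj wd w1.
pose f e x := if e \in b then x * iota e else x.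
have runE u x : run f u x = x * wval iota (restr b u).
  elim: u x => [|e u IH] x /=; first by rewrite wval_nil mulg1.
  by rewrite -/(run f u _) IH /f; case: ifP => // _; rewrite wval_cons mulgA.
have := @rich_compat K j gT f setT rG.
move=> /(_ _ _ _ d dj w wd w1 1 (in_setT _)); rewrite runE mul1g; apply.
- by move=> *; rewrite inE.
- by move=> e v _; rewrite /f; case: (e \in b) => //; rewrite -mulgA iotaK // mulg1.
move=> c v _; have [cb|cb] := boolP (c \subset b).
  left=> u uc u1; rewrite runE restr_id ?u1 ?mulg1 //; exact: word_in_sub uc.
right; exists (v *: gen iota (c :&: b)); rewrite subsetT; split=> //.
- by rewrite mem_lcoset mulVg gen_one.
- move=> e u ec; rewrite !mem_lcoset /f; case: ifP => // eb uD.
  by rewrite mulgA gen_mul ?gen_iota // inE ec.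
rewrite card_lcoset; apply: leq_trans (gen_le_sigma (setI_properl cb)) _.
by rewrite leq_pmull.
Qed.

End Retraction.

(** If a [b]-word [u] and a [d]-word [w] have the same value, deleting the letters outside [d] from
    [u ++ rev w] leaves [w] intact and turns [u] into a word over [b :&: d] with that value. *)
Lemma gen_setI K (b d : {set E}) : (0 < K)%N -> rich K #|E| ->
  gen iota b :&: gen iota d = gen iota (b :&: d).
Proof.
move=> K0 rG; apply/eqP; rewrite eqEsubset; apply/andP; split; last first.
  by rewrite subsetI !gen_sub ?subsetIl ?subsetIr.
apply/subsetP => x /setIP [/gen_wordP [u ub ->] /gen_wordP [w wd uw]].
have : wval iota (restr d (u ++ rev w)) = 1.
  apply: (@wval_restr K #|E| K0 rG setT d _ (max_card _) (word_inT (u ++ rev w))).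
  by rewrite wval_cat wval_rev // uw mulgV.
rewrite /restr filter_cat -!/(restr d _) wval_cat (restr_id (w := rev w)) ?word_in_rev //.
rewrite wval_rev // -uw => /eqP; rewrite -eq_mulgV1 => /eqP <-.
by apply: wval_gen; rewrite word_inI word_in_restr //= word_in_filter.
Qed.

End Rich.

(** * Actions on glued cosets *)

Section Pieces.
Variables (E T : finType) (gT : finGroupType) (iota : E -> gT).
Hypothesis inv : forall e, iota e ^+ 2 = 1.
Variables (lab : T -> {set E}) (valid : pred (T * gT)) (eqv : T * gT -> T * gT -> Prop).

(* Vertices of the glued graph are the [eqv]-classes of valid pairs; a letter [e]
   right-multiplies any representative whose piece is labelled by a set containing
   [e], and fixes the class if there is none. *)
Definition pcl (p : T * gT) : {set T * gT} := [set q | valid q && `[< eqv p q >]].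

Definition pact (e : E) (A : {set T * gT}) : {set T * gT} :=
  if [pick p in A | e \in lab p.1] is Some p then pcl (p.1, p.2 * iota e) else A.

Definition pverts : {set {set T * gT}} := [set pcl p | p in valid].

Hypothesis validM :
  forall t x e, valid (t, x) -> e \in lab t -> valid (t, x * iota e).
Hypothesis eqv_refl : forall p, valid p -> eqv p p.
Hypothesis eqv_sym : forall p q, eqv p q -> eqv q p.
Hypothesis eqv_trans : forall p q r, valid p -> valid q -> valid r ->
  eqv p q -> eqv q r -> eqv p r.
Hypothesis eqvM : forall t x t' x' e, valid (t, x) -> valid (t', x') ->
  eqv (t, x) (t', x') -> e \in lab t -> e \in lab t' ->
  eqv (t, x * iota e) (t', x' * iota e).

Lemma pcl_mem p : valid p -> p \in pcl p.
Proof. by move=> vp; rewrite inE vp; apply/asboolP/eqv_refl. Qed.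

Lemma pcl_eq p q : valid p -> valid q -> eqv p q -> pcl p = pcl q.
Proof.
move=> vp vq pq; apply/setP => r; rewrite !inE; case vr: (valid r) => //=.
apply/asboolP/asboolP => h; first exact: eqv_trans (eqv_sym pq) h.
exact: eqv_trans pq h.
Qed.

Lemma pcl_eqv p q : valid q -> pcl p = pcl q -> eqv p q.
Proof. by move=> vq e; have := pcl_mem vq; rewrite -e inE => /andP [_ /asboolP]. Qed.

Lemma pact_pcl t x e : valid (t, x) -> e \in lab t ->
  pact e (pcl (t, x)) = pcl (t, x * iota e).
Proof.
move=> v et; rewrite /pact; case: pickP => [[t' x'] /andP [/= ]|/(_ (t, x))].
  rewrite inE => /andP [v' /asboolP vv'] et'.
  apply: pcl_eq; try exact: validM.
  by apply: eqvM => //; apply: eqv_sym.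
by rewrite pcl_mem //= et.
Qed.

Lemma pact_block p e : valid p ->
  pact e (pcl p) = pcl p \/
  exists t x, [/\ valid (t, x), eqv p (t, x) & e \in lab t].
Proof.
move=> vp; rewrite /pact; case: pickP => [[t x] /andP [/= ]|]; last by left.
by rewrite inE => /andP [v /asboolP h] et; right; exists t, x.
Qed.

Lemma pact_word t x w : valid (t, x) -> word_in (lab t) w ->
  valid (t, x * wval iota w) /\ run pact w (pcl (t, x)) = pcl (t, x * wval iota w).
Proof.
elim: w x => [|e w IH] x v /=; first by rewrite wval_nil mulg1.
case/andP => et wt; rewrite -/(run pact w _) pact_pcl // wval_cons mulgA.
by apply: IH => //; apply: validM.
Qed.

Lemma pvertsP A : reflect (exists2 p, valid p & A = pcl p) (A \in pverts).
Proof. by apply: (iffP imsetP) => -[p vp ->]; exists p. Qed.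

Lemma pcl_verts p : valid p -> pcl p \in pverts.
Proof. by move=> vp; apply/pvertsP; exists p. Qed.

Lemma pact_verts e A : A \in pverts -> pact e A \in pverts.
Proof.
case/pvertsP => p vp ->; have [->|[t [x [v h et]]]] := pact_block e vp.
  exact: pcl_verts.
by rewrite (pcl_eq vp v h) pact_pcl // pcl_verts // validM.
Qed.

Lemma pactK e A : A \in pverts -> pact e (pact e A) = A.
Proof.
case/pvertsP => p vp ->; have [h|[t [x [v h et]]]] := pact_block e vp; first by rewrite !h.
by rewrite (pcl_eq vp v h) !pact_pcl ?validM // -mulgA iotaK // mulg1.
Qed.

Definition component (d : {set E}) (A : {set T * gT}) : {set {set T * gT}} :=
  [set B in pverts | `[< exists2 w, word_in d w & B = run pact w A >]].

Lemma component_sub d A : component d A \subset pverts.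
Proof. by apply/subsetP => B; rewrite inE => /andP []. Qed.

Lemma componentP d A B : A \in pverts ->
  reflect (exists2 w, word_in d w & B = run pact w A) (B \in component d A).
Proof.
move=> vA; rewrite inE; apply: (iffP andP) => [[_ /asboolP //]|h]; split; last exact/asboolP.
case: h => w wd ->; apply: (@run_closed E _ pact d) wd vA => e v _; exact: pact_verts.
Qed.

Lemma component_refl d A : A \in pverts -> A \in component d A.
Proof. by move=> vA; apply/componentP => //; exists [::]. Qed.

Lemma component_closed (d : {set E}) A e B : A \in pverts -> e \in d ->
  B \in component d A -> pact e B \in component d A.
Proof.
move=> vA ed /(componentP _ _ vA) [w wd ->]; apply/componentP => //.
by exists (rcons w e); rewrite ?word_in_rcons ?ed ?run_rcons.
Qed.

Lemma component_trans d A B C : A \in pverts ->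
  B \in component d A -> C \in component d B -> C \in component d A.
Proof.
move=> vA BA; have vB := subsetP (component_sub d A) _ BA.
case/(componentP _ _ vA): BA => u ud eB.
case/(componentP _ _ vB) => w wd ->; apply/componentP => //.
by exists (u ++ w); rewrite ?word_in_cat ?ud ?run_cat -?eB.
Qed.

Lemma component_sym d A B : A \in pverts -> B \in component d A -> A \in component d B.
Proof.
move=> vA BA; have vB := subsetP (component_sub d A) _ BA.
case/(componentP _ _ vA): BA => u ud eB; apply/componentP => //.
exists (rev u); rewrite ?word_in_rev // eB (@run_revK E _ pact d pverts) // => e v _.
  exact: pact_verts.
exact: pactK.
Qed.

Lemma pieces_compat K : rich iota K #|E| ->
    (forall d p, valid p ->
      (forall w, word_in d w -> wval iota w = 1 -> run pact w (pcl p) = pcl p) \/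
      (#|component d (pcl p)| <= K * sigma iota d)%N) ->
  forall w, wval iota w = 1 -> forall A, A \in pverts -> run pact w A = A.
Proof.
move=> rG cov w w1 A vA.
apply: (@rich_compat E gT iota K #|E| _ pact pverts rG _ _ _ setT (max_card _) w
  (word_inT _) w1 A vA).
- by move=> e v; apply: pact_verts.
- by move=> e v; apply: pactK.
move=> d B /pvertsP [p vp ->]; case: (cov d p vp) => [h|h]; [by left|right].
exists (component d (pcl p)); split=> //; first exact: component_sub.
  by apply: component_refl; apply: pcl_verts.
by move=> e u ed; apply: component_closed => //; apply: pcl_verts.
Qed.

End Pieces.

(** * Cycles of plain cosets *)

Lemma card_bigcup_le (I T : finType) (F : I -> {set T}) (P : pred I) (k : nat) :
  (forall i, P i -> (#|F i| <= k)%N) -> (#|\bigcup_(i | P i) F i| <= #|P| * k)%N.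
Proof.
move=> Fk; rewrite -sum_nat_const; apply: (@leq_trans (\sum_(i | P i) #|F i|)).
  elim/big_rec2: _ => [|i m A _ h]; first by rewrite cards0.
  by apply: leq_trans (leq_card_setU _ _) _; rewrite leq_add2l.
exact: leq_sum.
Qed.

Section Chain.
Variables (E : finType) (gT : finGroupType) (iota : E -> gT).
Hypothesis inv : forall e, iota e ^+ 2 = 1.
Variable K : nat.
Hypothesis rG : rich iota K #|E|.
Variables (m : nat) (g : nat -> gT) (a : nat -> {set E}).
Hypothesis mK : (m < K)%N.

Let K0 : (0 < K)%N. Proof. exact: leq_ltn_trans mK. Qed.

(** With [conn] and [gen_setI] this is the intersection of the cosets numbered [i] and [i.+1], both
    of which contain [g i.+1]. *)
Let overlap i : {set gT} := g i.+1 *: gen iota (a i :&: a i.+1).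

Hypothesis conn : forall i, (i <= m)%N -> (g i)^-1 * g i.+1 \in gen iota (a i).
Hypothesis sep : forall i x, (i.+2 <= m)%N -> x \in overlap i -> x \in overlap i.+1 -> False.

Let lab (i : 'I_m.+1) := a i.
Let valid : pred ('I_m.+1 * gT) := fun p => p.2 \in g p.1 *: gen iota (a p.1).
(** The gluing is linear: the last coset is not attached to the first by closing the cycle. *)
Let eqv (p q : 'I_m.+1 * gT) : Prop :=
  p.2 = q.2 /\ [\/ p.1 = q.1, q.1 = p.1.+1 :> nat /\ p.2 \in overlap p.1
                 | p.1 = q.1.+1 :> nat /\ p.2 \in overlap q.1].

Let validM t x e : valid (t, x) -> e \in lab t -> valid (t, x * iota e).
Proof. by rewrite /valid !mem_lcoset /= => v et; rewrite mulgA gen_mul // gen_iota. Qed.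

Let eqv_refl p : valid p -> eqv p p.
Proof. by move=> _; split=> //; apply: Or31. Qed.

Let eqv_sym p q : eqv p q -> eqv q p.
Proof.
case: p q => [i x] [j y] [/= -> [->|[]|[]]]; split => //=.
- exact: Or31.
- by move=> *; apply: Or33.
- by move=> *; apply: Or32.
Qed.

(** Two gluings in the same direction would place one element in two consecutive overlaps, against
    [sep]; two in opposite directions lead back to the same piece. *)
Let eqv_trans p q r : valid p -> valid q -> valid r ->
  eqv p q -> eqv q r -> eqv p r.
Proof.
case: p q r => [i x] [j y] [k z] _ _ _ [/= <- h] [/= <- h']; split=> //=.
case: h => [->|[ej oi]|[ei oj]]; first exact: h'.
  case: h' => [<-|[ek oj]|[ek ok]]; first by apply: Or32.
    case: (sep (i := i) (x := x)); rewrite -?ej //.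
    by rewrite -ek -ltnS.
  by apply: Or31; apply: val_inj; move: ek; rewrite ej => -[].
case: h' => [<-|[ek oj']|[ek ok]]; first by apply: Or33.
  by apply: Or31; apply: val_inj; rewrite /= ei ek.
case: (sep (i := k) (x := x)); rewrite -?ek //.
by rewrite -ei -ltnS.
Qed.

Let eqvM t x t' x' e : valid (t, x) -> valid (t', x') ->
  eqv (t, x) (t', x') -> e \in lab t -> e \in lab t' ->
  eqv (t, x * iota e) (t', x' * iota e).
Proof.
rewrite /lab => _ _ [/= <- h] et et'; split=> //=.
case: h => [->|[ej]|[ei]]; first exact: Or31.
  rewrite mem_lcoset => o; apply: Or32; split=> //.
  by rewrite mem_lcoset mulgA gen_mul // gen_iota // inE -ej et et'.
rewrite mem_lcoset => o; apply: Or33; split=> //.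
by rewrite mem_lcoset mulgA gen_mul // gen_iota // inE -ei et et'.
Qed.

Local Notation cl := (pcl valid eqv).
Local Notation ac := (pact iota lab valid eqv).

Let reach d i x w : valid (i, x) -> word_in d w ->
  exists j y, [/\ valid (j, y), run ac w (cl (i, x)) = cl (j, y) & x^-1 * y \in gen iota d].
Proof.
move=> v; elim/last_ind: w => [|w e IH].
  by move=> _; exists i, x; rewrite mulVg gen_one.
rewrite word_in_rcons run_rcons => /andP [ed /IH [j [y [v' -> xy]]]].
have [->|[k [z [vz /[dup] h [/= ez _] ek]]]] := pact_block iota lab eqv e v'.
  by exists j, y.
exists k, (z * iota e); split; first exact: validM.
  by rewrite (pcl_eq eqv_sym eqv_trans v' vz h) (pact_pcl validM eqv_refl eqv_sym eqv_trans eqvM).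
by rewrite mulgA gen_mul ?gen_iota // -ez.
Qed.

(* The second coordinate is the same in all representatives, so along a
   [d]-component it only moves inside one coset of [gen iota d]; intersecting with a
   piece [j] leaves a single coset of [gen iota (d :&: a j)]. *)
Lemma chain_compat w : wval iota w = 1 ->
  forall A, A \in pverts valid eqv -> run ac w A = A.
Proof.
apply: (pieces_compat inv validM eqv_refl eqv_sym eqv_trans eqvM rG) => d [i x] v.
(* If the component meets a piece whose label contains [d], it lies in that piece, where words act
   by right multiplication. *)
have [[j [y [vy Cy dj]]]|nd] :=
  pselect (exists j y, [/\ valid (j, y), cl (j, y) \in component iota lab valid eqv d (cl (i, x))
                         & d \subset a j]).
  left=> u ud u1; have vx := pcl_verts eqv v.
  have /(component_sym inv validM eqv_refl eqv_sym eqv_trans eqvM vx) := Cy.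
  have vj := pcl_verts eqv vy.
  case/(componentP validM eqv_refl eqv_sym eqv_trans eqvM _ _ vj) => w' wd' ->.
  have wj : word_in (lab j) w' by apply: word_in_sub wd'.
  have [vz ->] := pact_word validM eqv_refl eqv_sym eqv_trans eqvM vy wj.
  have uj : word_in (lab j) u by apply: word_in_sub ud.
  have [_ ->] := pact_word validM eqv_refl eqv_sym eqv_trans eqvM vz uj.
  by rewrite u1 mulg1.
right; set C := component _ _ _ _ _ _.
pose F (j : 'I_m.+1) := [set B in C | `[< exists2 y, valid (j, y) & B = cl (j, y) >]].
have CF : C \subset \bigcup_(j | true) F j.
  apply/subsetP => B CB; have vx := pcl_verts eqv v.
  have /(componentP validM eqv_refl eqv_sym eqv_trans eqvM _ _ vx) [u ud eB] := CB.
  have [j [y [vy e _]]] := reach v ud; apply/bigcupP; exists j => //.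
  by rewrite inE CB; apply/asboolP; exists y; rewrite // eB.
apply: leq_trans (subset_leq_card CF) _.
apply: (@leq_trans (#|[pred j : 'I_m.+1 | true]| * sigma iota d)); last first.
  by rewrite leq_mul2r -[#|_|]/#|'I_m.+1| card_ord mK orbT.
apply: card_bigcup_le => j _.
have [->|[B0]] := set_0Vmem (F j); first by rewrite cards0.
rewrite inE => /andP [CB0 /asboolP [y0 vy0 eB0]].
have dj : ~~ (d \subset a j).
  by apply/negP => h; apply: nd; exists j, y0; rewrite -eB0.
have inC k y : valid (k, y) -> cl (k, y) \in C -> x^-1 * y \in gen iota d.
  move=> vk; have vx := pcl_verts eqv v.
  case/(componentP validM eqv_refl eqv_sym eqv_trans eqvM _ _ vx) => u ud.
  have [l [z [vz -> xz]]] := reach v ud.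
  by case/(pcl_eqv eqv_refl vz) => /= ->.
have sub : F j \subset [set cl (j, y) | y in y0 *: gen iota (d :&: a j)].
  apply/subsetP => B; rewrite inE => /andP [CB /asboolP [y vy eB]].
  apply/imsetP; exists y => //; rewrite mem_lcoset -(gen_setI inv d (a j) K0 rG) inE.
  have -> : y0^-1 * y = (x^-1 * y0)^-1 * (x^-1 * y).
    by rewrite invMg invgK mulgA mulgK.
  apply/andP; split.
    by apply: gen_mul; [apply: gen_inv; apply: (inC j); rewrite -?eB0 | apply: (inC j); rewrite -?eB].
  have -> : (x^-1 * y0)^-1 * (x^-1 * y) = ((g j)^-1 * y0)^-1 * ((g j)^-1 * y).
    by rewrite !invMg !invgK !mulgA !mulgK.
  by move: vy vy0; rewrite /valid !mem_lcoset => h h0; apply: gen_mul; first exact: gen_inv.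
apply: leq_trans (subset_leq_card sub) _; apply: leq_trans (leq_imset_card _ _) _.
by rewrite card_lcoset; apply: gen_le_sigma; apply: setI_properl.
Qed.

(** Passing once through all pieces spells a word of value [(g 0)^-1 * g m.+1], which is 1, so it
    returns to its start. Hence [g 0] in piece [m] and in piece 0 are one vertex, and the linear
    gluing only identifies points of neighbouring pieces. *)
Lemma chain_open : (0 < m)%N -> g m.+1 = g 0%N -> m = 1%N /\ g 0%N \in overlap 0.
Proof.
move=> m0 gm.
have vI i : (i <= m)%N -> valid (inord i, g i).
  by move=> im; rewrite /valid mem_lcoset /= inordK ?ltnS // mulVg gen_one.
have vS i : (i <= m)%N -> valid (inord i, g i.+1).
  by move=> im; rewrite /valid mem_lcoset /= inordK ?conn // ltnS.
have walk k : (k <= m)%N -> exists w, wval iota w = (g 0%N)^-1 * g k.+1 /\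
    run ac w (cl (inord 0, g 0%N)) = cl (inord k, g k.+1).
  elim: k => [|k IH] km.
    have /gen_wordP [w wa ew] := conn km; exists w; split=> //.
    have wl : word_in (lab (inord 0)) w by rewrite /lab inordK.
    have [_ ->] := pact_word validM eqv_refl eqv_sym eqv_trans eqvM (vI _ km) wl.
    by rewrite -ew mulKVg.
  have [u [eu ru]] := IH (ltnW km).
  have /gen_wordP [w wa ew] := conn km.
  have wl : word_in (lab (inord k.+1)) w by rewrite /lab inordK.
  exists (u ++ w); rewrite wval_cat eu -ew mulgA mulgK; split=> //.
  rewrite run_cat ru.
  have -> : cl (inord k, g k.+1) = cl (inord k.+1, g k.+1).
    apply: (pcl_eq eqv_sym eqv_trans (vS _ (ltnW km)) (vI _ km)); split=> //=.
    apply: Or32; rewrite !inordK ?ltnS ?(ltnW km) //; split=> //.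
    by rewrite mem_lcoset mulVg gen_one.
  have [_ ->] := pact_word validM eqv_refl eqv_sym eqv_trans eqvM (vI _ km) wl.
  by rewrite -ew mulKVg.
have [w [w1]] := walk m (leqnn m); rewrite gm mulVg in w1 *.
rewrite (chain_compat w1) ?(pcl_verts _ (vI 0%N _)) // => e.
have := vS m (leqnn m); rewrite gm => vm.
have [_ /= []] := pcl_eqv eqv_refl vm e.
- by move/(congr1 val); rewrite /= !inordK // => m00; rewrite -m00 in m0.
- by rewrite !inordK // => -[-> o].
by rewrite !inordK // => -[].
Qed.

End Chain.

(** * Coset extensions of the constraint graph *)

Section Constraint.
Variables (E S : finType) (R : E -> rel S) (HI : is_Egraph R).
Variables (gT : finGroupType) (iota : E -> gT).
Hypothesis inv : forall e, iota e ^+ 2 = 1.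
Hypothesis Hcomp : compatible R iota.

Lemma walk_cat s u r v t : walk R s u r -> walk R r v t -> walk R s (u ++ v) t.
Proof.
elim: u s => [|e u IH] s /=; first by move->.
by case=> s' [ss' h] h'; exists s'; split=> //; apply: IH.
Qed.

Lemma walk_rev s w t : walk R s w t -> walk R t (rev w) s.
Proof.
elim: w s => [|e w IH] s /=; first by move->.
case=> s' [ss' h]; rewrite rev_cons -cats1; apply: walk_cat (IH _ h) _.
by exists s; split=> //; apply: HI.1.
Qed.

Lemma walk_pi s w t : walk R s w t -> pi_w R w s = t.
Proof.
elim: w s => [|e w IH] s //= [s' [ss' h]].
rewrite -(IH _ h) /pi_w /=; congr foldl; rewrite /pi_e.
case: pickP => [u su|/(_ s')]; last by rewrite ss'.
exact: HI.2 su ss'.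
Qed.

Definition walk_val (b : {set E}) (s t : S) (x : gT) : Prop :=
  exists w, in_words_st R b s t w /\ x = wval iota w.

Lemma walk_val1 b s : walk_val b s s 1.
Proof. by exists [::]; rewrite wval_nil. Qed.

Lemma walk_valM b s r t x y : walk_val b s r x -> walk_val b r t y -> walk_val b s t (x * y).
Proof.
move=> [u [[bu hu] ->]] [v [[bv hv] ->]]; exists (u ++ v); rewrite wval_cat; split=> //.
by split; [rewrite all_cat bu | apply: walk_cat hv].
Qed.

Lemma walk_valV b s t x : walk_val b s t x -> walk_val b t s x^-1.
Proof.
move=> [u [[bu hu] ->]]; exists (rev u); rewrite wval_rev //; split=> //.
by split; [rewrite all_rev | apply: walk_rev].
Qed.

Lemma walk_val_sub (b d : {set E}) s t x : b \subset d -> walk_val b s t x -> walk_val d s t x.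
Proof.
move=> bd [u [[bu hu] ->]]; exists u; split=> //; split=> //.
exact: (word_in_sub bd).
Qed.

Lemma walk_val_gen b s t x : walk_val b s t x -> x \in gen iota b.
Proof. by move=> [u [[bu hu] ->]]; apply: wval_gen. Qed.

(** Compatibility with the constraint graph enters here: a word of value 1 fixes all its
    vertices. *)
Lemma walk_val_one b s t : walk_val b s t 1 -> s = t.
Proof. by move=> [w [[_ /walk_pi <-] /esym w1]]; rewrite (Hcomp w1). Qed.

Variable K : nat.
Hypothesis rG : rich iota K #|E|.
(** The extension has at most one piece for each pair in [S * {set E}], so [K] exceeds the number of
    pieces. *)
Hypothesis SK : (#|{: S * {set E}}| < K)%N.

Let K0 : (0 < K)%N. Proof. exact: leq_ltn_trans SK. Qed.

Let gI b d := gen_setI inv b d K0 rG.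

Local Notation T := (S * {set E})%type.

Definition factors (b : {set E}) : Prop :=
  forall s t (c d : {set E}) x y, c \subset b -> d \subset b ->
    x \in gen iota c -> y \in gen iota d -> walk_val b s t (x * y) ->
  exists p u v, [/\ walk_val c s p u, walk_val d t p v & x * y = u * v^-1].

Definition lab (t : T) : {set E} := t.2.

(* The triple [((s, b), g)] stands for the end of a path with value [g] in the copy
   of [gen iota b] attached at [s].  Two triples agree if, up to walks in the
   constraint graph, both are reached from a common vertex [r] by the same element
   of the common subgroup. *)
Definition ce_valid (a : {set E}) : pred (T * gT) :=
  fun p => (p.1.2 \proper a) && (p.2 \in gen iota p.1.2).

Definition ce_eqv (p q : T * gT) : Prop :=
  exists r u v x, [/\ walk_val p.1.2 p.1.1 r u, walk_val q.1.2 q.1.1 r v,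
    x \in gen iota (p.1.2 :&: q.1.2), p.2 = u * x & q.2 = v * x].

Lemma ce_validM a t x e : ce_valid a (t, x) -> e \in lab t -> ce_valid a (t, x * iota e).
Proof.
case/andP=> /= ta xt et; rewrite /ce_valid /= ta /=.
by apply: gen_mul => //; apply: gen_iota.
Qed.

Lemma ce_eqv_refl (a : {set E}) p : ce_valid a p -> ce_eqv p p.
Proof.
case/andP => _ h; exists p.1.1, 1, 1, p.2.
by rewrite mul1g setIid; split=> //; apply: walk_val1.
Qed.

Lemma ce_eqv_sym p q : ce_eqv p q -> ce_eqv q p.
Proof. by case=> r [u [v [x [hu hv hx eu ev]]]]; exists r, v, u, x; rewrite setIC. Qed.

Lemma ce_eqvM a t x t' x' e : ce_valid a (t, x) -> ce_valid a (t', x') ->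
  ce_eqv (t, x) (t', x') -> e \in lab t -> e \in lab t' ->
  ce_eqv (t, x * iota e) (t', x' * iota e).
Proof.
move=> _ _ [r [u [v [z [/= hu hv hz -> ->]]]]] et et'; exists r, u, v, (z * iota e).
by rewrite !mulgA; split=> //=; apply: gen_mul => //; apply: gen_iota; rewrite inE et.
Qed.

Lemma ce_eqv_grow s (b d : {set E}) g : b \subset d -> g \in gen iota b ->
  ce_eqv ((s, b), g) ((s, d), g).
Proof.
move=> bd gb; exists s, 1, 1, g; rewrite !mul1g.
by split; rewrite //= ?(setIidPl bd) //; apply: walk_val1.
Qed.

Lemma ce_eqv_move s (b d : {set E}) r u x : d \subset b -> walk_val b s r u ->
  x \in gen iota d -> ce_eqv ((s, b), u * x) ((r, d), x).
Proof.
move=> db hu xd; exists r, u, 1, x; rewrite mul1g.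
by split; rewrite //= ?(setIidPr db) //; apply: walk_val1.
Qed.

(** The two coincidences yield a [b']-walk between their meeting vertices with value [x * y^-1].
    Splitting it by [factors] gives a common meeting vertex, and [gI] places the remaining element
    in the subgroup of [b :&: b'']. *)
Lemma ce_eqv_trans (a : {set E}) : (forall b : {set E}, b \proper a -> factors b) ->
  forall p q r, ce_valid a p -> ce_valid a q -> ce_valid a r ->
  ce_eqv p q -> ce_eqv q r -> ce_eqv p r.
Proof.
move=> fa [[s b] g] [[s' b'] g'] [[s'' b''] g''] _ /andP [/= b'a _] _.
move=> [r [u [u' [x [/= hu hu' hx -> ->]]]]] [q [v [v' [y [/= hv hv' hy e ->]]]]].
have hw : walk_val b' r q (x * y^-1).
  have -> : x * y^-1 = u'^-1 * v by apply: (mulgI u'); rewrite mulgA e mulgK mulKVg.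
  by apply: walk_valM hv; apply: walk_valV.
have [] := fa b' b'a r q (b :&: b') (b' :&: b'') x y^-1 (subsetIr _ _) (subsetIl _ _) hx _ hw.
  exact: gen_inv.
move=> p [c [d [hc hd ecd]]]; exists p, (u * c), (v' * d), (c^-1 * x).
have ex : c^-1 * x = d^-1 * y.
  by apply: (mulgI c); rewrite mulKVg mulgA -ecd mulgKV.
split=> /=.
- by apply: walk_valM hu _; apply: walk_val_sub hc; apply: subsetIl.
- by apply: walk_valM hv' _; apply: walk_val_sub hd; apply: subsetIr.
- have /(subsetP (gen_sub iota (subsetIl b b'))) xb := hx.
  have /(subsetP (gen_sub iota (subsetIr b' b''))) yb := hy.
  rewrite -gI inE; apply/andP; split.
    apply: gen_mul xb; apply: gen_inv.
    by apply: (subsetP (gen_sub iota (subsetIl b b'))); apply: walk_val_gen hc.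
  rewrite ex; apply: gen_mul yb; apply: gen_inv.
  by apply: (subsetP (gen_sub iota (subsetIr b' b''))); apply: walk_val_gen hd.
- by rewrite mulgA mulgK.
by rewrite ex mulgA mulgK.
Qed.

Local Notation cl a := (pcl (ce_valid a) ce_eqv).
Local Notation ac a := (pact iota lab (ce_valid a) ce_eqv).
Local Notation verts a := (pverts (ce_valid a) ce_eqv).
Local Notation proper_factors a := (forall b : {set E}, b \proper a -> factors b).

Definition ce_compat (a : {set E}) : Prop :=
  forall w, wval iota w = 1 -> forall A, A \in verts a -> run (ac a) w A = A.

(* A representative whose label is of minimal size in a [d]-component is a gate:
   every vertex of the component is reached from it inside a single piece. *)
Definition ce_gate (a : {set E}) : Prop :=
  forall (d : {set E}) s b g, ce_valid a ((s, b), g) -> b != set0 ->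
    (forall w p, word_in d w -> ce_valid a p ->
       run (ac a) w (cl a ((s, b), g)) = cl a p -> (#|b| <= #|p.1.2|)%N) ->
  forall w, word_in d w -> exists (c : {set E}) h,
    [/\ b \subset c, c \proper a, h \in gen iota (d :&: c) &
        run (ac a) w (cl a ((s, b), g)) = cl a ((s, c), g * h)].

Section Extension.
Variable a : {set E}.
Hypothesis fa : proper_factors a.

Let vM := @ce_validM a.
Let er := @ce_eqv_refl a.
Let et := ce_eqv_trans fa.
Let eM := @ce_eqvM a.

Lemma ce_eq p q : ce_valid a p -> ce_valid a q -> ce_eqv p q -> cl a p = cl a q.
Proof. exact: (pcl_eq ce_eqv_sym et). Qed.

Lemma ce_run t x w : ce_valid a (t, x) -> word_in t.2 w ->
  ce_valid a (t, x * wval iota w) /\ run (ac a) w (cl a (t, x)) = cl a (t, x * wval iota w).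
Proof. exact: (pact_word vM er ce_eqv_sym et eM). Qed.

Lemma ce_act t x e : ce_valid a (t, x) -> e \in t.2 ->
  ce_valid a (t, x * iota e) /\ ac a e (cl a (t, x)) = cl a (t, x * iota e).
Proof.
move=> v et'; split; first exact: vM.
exact: (pact_pcl vM er ce_eqv_sym et eM).
Qed.

Lemma ce_run_verts w A : A \in verts a -> run (ac a) w A \in verts a.
Proof.
apply: (@run_closed E _ _ setT _ w) (word_inT _) => e v _.
exact: (pact_verts vM er ce_eqv_sym et eM).
Qed.

Lemma ce_run_revK w A : A \in verts a -> run (ac a) (rev w) (run (ac a) w A) = A.
Proof.
apply: (@run_revK E _ _ setT _ w) (word_inT _) => e v _.
  exact: (pact_verts vM er ce_eqv_sym et eM).
exact: (pactK inv vM er ce_eqv_sym et eM).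
Qed.

Lemma ce_run_eq u w A : ce_compat a -> A \in verts a -> wval iota u = wval iota w ->
  run (ac a) u A = run (ac a) w A.
Proof.
move=> ca vA uw; rewrite -{2}(ca (u ++ rev w) _ _ vA); last first.
  by rewrite wval_cat wval_rev // uw mulgV.
by rewrite run_cat; have := ce_run_revK (rev w) (ce_run_verts u vA); rewrite revK => ->.
Qed.

Lemma ce_grow s (b c : {set E}) g : b \subset c -> c \proper a -> g \in gen iota b ->
  ce_valid a ((s, c), g) /\ cl a ((s, b), g) = cl a ((s, c), g).
Proof.
move=> bc ca gb.
have vc : ce_valid a ((s, c), g).
  by rewrite /ce_valid /= ca (subsetP (gen_sub iota bc)).
split=> //; apply: ce_eq => //; last exact: ce_eqv_grow.
by rewrite /ce_valid /= gb andbT; apply: sub_proper_trans ca.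
Qed.

Lemma ce_valid0 s : a != set0 -> ce_valid a ((s, set0), 1).
Proof. by move=> a0; rewrite /ce_valid /= gen_one andbT proper0. Qed.

Lemma ce_base s (b : {set E}) w : b \proper a -> word_in b w ->
  run (ac a) w (cl a ((s, set0), 1)) = cl a ((s, b), wval iota w).
Proof.
move=> ba bw; have [v ->] := ce_grow s (sub0set b) ba (gen_one iota set0).
by have [_ ->] := ce_run v bw; rewrite mul1g.
Qed.

(** The vertices [((s, set0), 1)] carry the constraint graph: as [a] has two letters, an edge [e]
    can be followed in the piece labelled [[set e]], whose far end is identified with the next such
    vertex. *)
Lemma ce_walk s t w : (1 < #|a|)%N -> in_words_st R a s t w ->
  run (ac a) w (cl a ((s, set0), 1)) = cl a ((t, set0), 1).
Proof.
move=> a2 [wa]; elim: w wa s => [|e w IH] /= wa s; first by move->.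
case/andP: wa => ea wa [s' [ss' h]]; rewrite -(IH wa _ h); congr foldl.
have e1 : [set e] \proper a by rewrite properEcard sub1set ea cards1.
have [v ->] := ce_grow s (sub0set [set e]) e1 (gen_one iota set0).
have [v' ->] := ce_act v (set11 e); rewrite mul1g in v' *.
apply: ce_eq => //; first by apply: ce_valid0; rewrite -card_gt0 ltnW.
rewrite -[iota e]mulg1; apply: ce_eqv_move; rewrite ?sub0set ?gen_one //.
exists [:: e]; rewrite wval_cons wval_nil mulg1; split=> //; split; rewrite /= ?set11 //.
by exists s'.
Qed.

(* A letter blocked in the smaller extension may act in the larger one, so only
   a subword of [w] can be followed there. *)
Lemma ce_transfer (b d : {set E}) p w : b \proper a -> ce_valid b p -> word_in d w ->
  exists v q, [/\ word_in d v, ce_valid b q, run (ac b) w (cl b p) = cl b q &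
                  run (ac a) v (cl a p) = cl a q].
Proof.
move=> ba vp.
have fb : proper_factors b by move=> c cb; apply: fa; apply: proper_trans ba.
have vab q : ce_valid b q -> ce_valid a q.
  by case/andP=> h1 h2; rewrite /ce_valid h2 (proper_trans h1 ba).
elim/last_ind: w => [|w e IH]; first by exists [::], p.
rewrite word_in_rcons run_rcons => /andP [ed /IH [v [q [dv vq -> eq]]]].
have [->|[t [x [vt qt et']]]] := pact_block iota lab ce_eqv e vq; first by exists v, q.
exists (rcons v e), (t, x * iota e).
rewrite word_in_rcons ed run_rcons eq (ce_eq (vab _ vq) (vab _ vt) qt).
have [_ ->] := ce_act (vab _ vt) et'.
split=> //; first exact: ce_validM.
rewrite (pcl_eq ce_eqv_sym (ce_eqv_trans fb) vq vt qt).
exact: (pact_pcl (@ce_validM b) (@ce_eqv_refl b) ce_eqv_sym (ce_eqv_trans fb) (@ce_eqvM b)).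
Qed.

End Extension.

(** * The simultaneous induction on the set of letters *)

Section Induction.
Variable a : {set E}.
Hypothesis fa : proper_factors a.

Let vM := @ce_validM a.
Let er := @ce_eqv_refl a.
Let et := ce_eqv_trans fa.
Let eM := @ce_eqvM a.

(* Take the representative [((s, b), g * h)] of the current vertex with [b] minimal.
   If a second representative with label [c] does not contain [b], the coincidence
   of the two already takes place in the extension for [b], where the gate property
   produces a representative with a label smaller than [b]. *)
Lemma ce_gate_step : (forall b : {set E}, b \proper a -> ce_gate b) ->
  (forall b : {set E}, b \proper a -> ce_compat b) -> ce_gate a.
Proof.
move=> IHg IHc d s b0 g vp b00 minb; elim/last_ind => [|w e IH].
  move=> _; exists b0, 1; rewrite mulg1 gen_one; split=> //.
  by case/andP: vp.
rewrite word_in_rcons run_rcons => /andP [ed wd].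
pose P n := `[< exists (c : {set E}) h, [/\ b0 \subset c, c \proper a, h \in gen iota (d :&: c),
  run (ac a) w (cl a ((s, b0), g)) = cl a ((s, c), g * h) & #|c| = n] >].
have exP : exists n, P n.
  have [c [h [h1 h2 h3 h4]]] := IH wd.
  by exists #|c|; apply/asboolP; exists c, h.
case: (ex_minnP exP) => n /asboolP [b [h [b0b ba hd rw <-{n}]]] minn.
have gb0 : g \in gen iota b0 by case/andP: vp.
have gb : g \in gen iota b by apply: (subsetP (gen_sub iota b0b)).
have hb : h \in gen iota b by apply: (subsetP (gen_sub iota (subsetIr d b))).
have v1 : ce_valid a ((s, b), g * h) by rewrite /ce_valid /= ba gen_mul.
rewrite rw; have [->|[[s1 c] [y [vt eqt ec]]]] := pact_block iota lab ce_eqv e v1.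
  by exists b, h.
have ca : c \proper a by case/andP: vt.
have [bc|bc] := boolP (b \subset c).
  have [v2 ->] := ce_grow fa s bc ca (gen_mul gb hb).
  have [_ ->] := ce_act fa v2 ec; exists c, (h * iota e); rewrite mulgA; split=> //.
    exact: subset_trans bc.
  apply: gen_mul; last by apply: gen_iota; rewrite inE ed.
  by apply: (subsetP (gen_sub iota (setIS d bc))).
have bcb : b :&: c \proper b by apply: setI_properl.
case: eqt => r [u [v [x [/= hu _ hx ghx _]]]].
have vr : ce_valid a ((r, b :&: c), x).
  by rewrite /ce_valid /= hx (proper_trans bcb ba).
have rwr : run (ac a) w (cl a ((s, b0), g)) = cl a ((r, b :&: c), x).
  rewrite rw; apply: (ce_eq fa) => //; rewrite ghx; apply: ce_eqv_move => //.
  exact: proper_sub.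
(* The vertex also has a representative labelled [b :&: c], so minimality gives [b0] at most the
   size of [b :&: c], which is smaller than [b]. *)
have b0b' : b0 \proper b.
  rewrite properEcard b0b; apply: leq_ltn_trans (proper_card bcb).
  exact: minb rwr.
have b2 : (1 < #|b|)%N by apply: leq_ltn_trans (proper_card b0b'); rewrite card_gt0.
have fb : proper_factors b by move=> c' c'b; apply: fa; apply: proper_trans ba.
have b1 : b != set0 by rewrite -card_gt0 ltnW.
have /gen_wordP [gw gwb eg] := gb0.
have /gen_wordP [hw hwd eh] := hd.
have /gen_wordP [xw xwb ex] := hx.
case: (hu) => uw [hus eu].
have vb0 : ce_valid b ((s, b0), g) by rewrite /ce_valid /= b0b'.
have vbr : ce_valid b ((r, b :&: c), x) by rewrite /ce_valid /= hx bcb.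
(* The words [gw ++ hw] and [uw ++ xw] have the same value, so they act alike in the extension for
   [b]; the second one walks to [r] and then applies [x]. *)
have move_hw : run (ac b) hw (cl b ((s, b0), g)) = cl b ((r, b :&: c), x).
  have vs : cl b ((s, set0), 1) \in verts b by apply: pcl_verts; apply: ce_valid0.
  have := ce_run_eq fb (u := gw ++ hw) (w := uw ++ xw) (IHc b ba) vs.
  rewrite !wval_cat -eg -eh -eu -ex => /(_ ghx); rewrite !run_cat (ce_walk fb b2 hus).
  by rewrite (ce_base fb s b0b' gwb) (ce_base fb r bcb xwb) -eg -ex.
have [] := IHg b ba d s b0 g vb0 b00 _ hw.
(* Minimality of [b0] is inherited by the smaller extension through [ce_transfer]. *)
- move=> z p dz vpb rz.
  have [z' [q [dz' vq rq rq']]] := ce_transfer fa ba vb0 dz.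
  have vab p' : ce_valid b p' -> ce_valid a p'.
    by case/andP=> h1 h2; rewrite /ce_valid h2 (proper_trans h1 ba).
  apply: (minb z') => //; first exact: vab.
  rewrite rq'; apply: (ce_eq fa); try exact: vab.
  by apply: (pcl_eqv (@ce_eqv_refl b) vpb); rewrite -rq.
- by move: hwd; rewrite word_inI => /andP [].
move=> c2 [k [b0c2 c2b kd]]; rewrite move_hw => e2.
have c2a := proper_trans c2b ba.
have v2 : ce_valid b ((s, c2), g * k).
  rewrite /ce_valid /= c2b gen_mul //; first exact: (subsetP (gen_sub iota b0c2)).
  exact: (subsetP (gen_sub iota (subsetIr d c2))).
(* The gate found for [b] is also one in the extension for [a], with [c2] proper in [b]; this
   contradicts the choice of [b]. *)
have : (#|b| <= #|c2|)%N.
  apply: minn; apply/asboolP; exists c2, k; split=> //.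
  rewrite rwr; apply: (ce_eq fa) => //; last exact: (pcl_eqv (@ce_eqv_refl b) v2).
  by case/andP: v2 => _ h2; rewrite /ce_valid h2 c2a.
by rewrite leqNgt (proper_card c2b).
Qed.

(** Each [d]-component satisfies one of the alternatives of [pieces_compat]; the cases depend on the
    smallest label [b] of a representative in it. *)
Lemma ce_compat_step : ce_gate a -> ce_compat a.
Proof.
move=> ga w0 w01 A vA.
apply: (pieces_compat inv vM er ce_eqv_sym et eM rG _ w01 vA) => {w0 w01 A vA} d p vp.
pose P n := `[< exists w q, [/\ word_in d w, ce_valid a q,
  run (ac a) w (cl a p) = cl a q & #|q.1.2| = n] >].
have exP : exists n, P n by exists #|p.1.2|; apply/asboolP; exists [::], p.
case: (ex_minnP exP) => n /asboolP [w0 [[[s b] g] [w0d vq rw0 <-{n}]]] minn.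
have gb : g \in gen iota b by case/andP: vq.
have cpE : cl a p = run (ac a) (rev w0) (cl a ((s, b), g)).
  by rewrite -rw0 (ce_run_revK fa) // pcl_verts.
have sT : (#|{set E}| <= #|{: T}|)%N.
  by rewrite card_prod leq_pmull //; apply/card_gt0P; exists s.
have [b0|b0] := eqVneq b set0.
  have g1 : g = 1 by move: gb; rewrite b0 => /in_gen0.
  subst b g.
  (* All labels are proper in [a], hence in [d], so the whole extension is small enough. *)
  have [ad|ad] := boolP (a \subset d).
    right; apply: leq_trans (subset_leq_card (component_sub _ _ _ _ _ _)) _.
    pose F (t : T) := [set cl a (t, x) | x in gen iota t.2].
    have sub : verts a \subset \bigcup_(t : T | t.2 \proper a) F t.
      apply/subsetP => B /pvertsP [[t x] /andP [/= ta xt] ->].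
      by apply/bigcupP; exists t => //; apply: imset_f.
    apply: leq_trans (subset_leq_card sub) _.
    apply: leq_trans (card_bigcup_le (k := sigma iota d) _) _.
      move=> t ta; apply: leq_trans (leq_imset_card _ _) _.
      by apply: gen_le_sigma; apply: proper_sub_trans ad.
    by rewrite leq_mul2r (leq_trans (max_card _) (ltnW SK)) orbT.
  (* Letters outside [a] lie in no label and act trivially, so a [d]-word acts in the piece of
     [d :&: a] through its restriction to [a]. *)
  left; have da : d :&: a \proper a by rewrite setIC; apply: setI_properl.
  have fullrun v x : word_in d v -> x \in gen iota (d :&: a) ->
      run (ac a) v (cl a ((s, d :&: a), x)) = cl a ((s, d :&: a), x * wval iota (restr a v)) /\
      x * wval iota (restr a v) \in gen iota (d :&: a).
    elim: v x => [|e v IH] x /=; first by rewrite wval_nil mulg1.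
    case/andP => ed dv xd; have vx : ce_valid a ((s, d :&: a), x) by rewrite /ce_valid /= da.
    case: ifP => ea.
      have eda : e \in d :&: a by rewrite inE ed.
      have [v2 ->] := ce_act fa vx eda; rewrite wval_cons mulgA.
      by apply: IH => //; apply: gen_mul => //; apply: gen_iota.
    have [->|[t [y [/andP [/= ta _] _ et']]]] := pact_block iota lab ce_eqv e vx.
      exact: IH.
    by move/proper_sub/subsetP/(_ e et'): ta; rewrite ea.
  move=> w dw w1; rewrite cpE.
  have [_ ->] := ce_grow fa s (sub0set _) da (gen_one iota set0).
  have [] := fullrun (rev w0) 1; rewrite ?word_in_rev ?gen_one // => -> h.
  have [-> _] := fullrun w _ dw h.
  by rewrite (wval_restr inv K0 rG a (max_card _) dw w1) mulg1.
have [[c [bc ca dc]]|nc] := pselect (exists c : {set E}, [/\ b \subset c, c \proper a & d \subset c]).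
  left=> w dw w1; rewrite cpE; have [vc ->] := ce_grow fa s bc ca gb.
  have [|vz ->] := ce_run fa (w := rev w0) vc; first by rewrite word_in_rev; apply: word_in_sub w0d.
  by have [|_ ->] := ce_run fa (w := w) vz; [apply: word_in_sub dw | rewrite w1 mulg1].
right; have vpv := pcl_verts ce_eqv vp.
have qp : cl a ((s, b), g) \in component iota lab (ce_valid a) ce_eqv d (cl a p).
  by apply/(componentP vM er ce_eqv_sym et eM) => //; exists w0.
have pq := component_sym inv vM er ce_eqv_sym et eM vpv qp.
(* The gate property keeps [s] fixed, so the pieces are counted by [c] alone, and by [nc] none of
   these [c] contains [d]. *)
pose F (c : {set E}) := [set cl a ((s, c), g * h) | h in gen iota (d :&: c)].
have sub : component iota lab (ce_valid a) ce_eqv d (cl a p)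
    \subset \bigcup_(c : {set E} | (b \subset c) && (c \proper a)) F c.
  have vqv := pcl_verts ce_eqv vq.
  apply/subsetP => B /(component_trans vM er ce_eqv_sym et eM vqv pq).
  case/(componentP vM er ce_eqv_sym et eM _ _ vqv) => w dw ->.
  have [] := ga d s b g vq b0 _ w dw.
    move=> v q dv vq' rv; apply: minn; apply/asboolP; exists (w0 ++ v), q.
    by rewrite word_in_cat w0d run_cat rw0.
  move=> c [h [bc ca hd ->]]; apply/bigcupP; exists c; first by rewrite bc.
  exact: imset_f.
apply: leq_trans (subset_leq_card sub) _.
apply: leq_trans (card_bigcup_le (k := sigma iota d) _) _.
  move=> c /andP [bc ca]; apply: leq_trans (leq_imset_card _ _) _.
  apply: gen_le_sigma; apply: setI_properl; apply/negP => dc.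
  by apply: nc; exists c.
by rewrite leq_mul2r (leq_trans (max_card _) (leq_trans sT (ltnW SK))) orbT.
Qed.

(** The walk and the product [x * y] act alike on the base vertex at [s]. Undoing [y] from the base
    vertex at [t] identifies [((s, c), x)] with [((t, d), y^-1)], and [ce_eqv] then supplies the
    meeting vertex and both walks. *)
Lemma factors_step : ce_compat a -> factors a.
Proof.
move=> ca s t c d x y csa dsa xc yd hw.
have [ac|nac] := boolP (a \subset c).
  exists t, (x * y), 1; rewrite invg1 mulg1; split=> //; last exact: walk_val1.
  exact: walk_val_sub hw.
have [ad|nad] := boolP (a \subset d).
  exists s, 1, (x * y)^-1; rewrite invgK mul1g; split=> //; first exact: walk_val1.
  by apply: walk_valV; apply: walk_val_sub hw.
have pc : c \proper a by rewrite properE csa.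
have pd : d \proper a by rewrite properE dsa.
(* With at most one letter in [a], proper subsets are empty, so [x = y = 1] and the walk is
   closed. *)
have [a2|a1] := ltnP 1 #|a|; last first.
  have z (b : {set E}) : b \proper a -> b = set0.
    move/proper_card => h; apply/eqP; rewrite -cards_eq0 -leqn0 -ltnS.
    exact: leq_trans a1.
  have x1 : x = 1 by move: xc; rewrite (z c) // => /in_gen0.
  have y1 : y = 1 by move: yd; rewrite (z d) // => /in_gen0.
  rewrite x1 y1 mul1g in hw *; exists s, 1, 1; rewrite invg1 mulg1.
  by rewrite -(walk_val_one hw); split=> //; apply: walk_val1.
have a0 : a != set0 by rewrite -card_gt0 ltnW.
have /gen_wordP [xw xwc ex] := xc; have /gen_wordP [yw ywd ey] := yd.
case: hw => w [sw ew].
have vs : cl a ((s, set0), 1) \in verts a by apply: pcl_verts; apply: ce_valid0.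
have := ce_run_eq fa (u := xw ++ yw) (w := w) ca vs.
rewrite wval_cat -ex -ey => /(_ ew); rewrite (ce_walk fa a2 sw) run_cat (ce_base fa s pc xwc) -ex => e1.
have vx : ce_valid a ((s, c), x) by rewrite /ce_valid /= pc.
have vy : ce_valid a ((t, d), y^-1) by rewrite /ce_valid /= pd gen_inv.
have := ce_run_revK fa yw (pcl_verts ce_eqv vx).
rewrite e1 (ce_base fa t pd) ?word_in_rev // wval_rev // -ey => /esym/(pcl_eqv er vy).
case=> r [u [v [z [/= hu hv _ -> ey']]]]; exists r, u, v; split=> //.
by rewrite -[y]invgK ey' invMg mulgA mulgK.
Qed.

End Induction.

(** Factorization below [a] makes the gluing transitive; gates and compatibility below give gates at
    [a], these give compatibility at [a], and that gives factorization at [a]. *)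
Lemma factorsT (a : {set E}) : factors a.
Proof.
suff /(_ a) : forall b : {set E}, [/\ ce_gate b, ce_compat b & factors b] by case.
move=> {}a; have [n] := ubnP #|a|; elim: n a => // n IH a an.
have IHa (b : {set E}) : b \proper a -> [/\ ce_gate b, ce_compat b & factors b].
  by move=> ba; apply: IH; apply: leq_trans (proper_card ba) _.
have fa : proper_factors a by move=> b /IHa [].
have ga : ce_gate a.
  by apply: (ce_gate_step fa) => b /IHa [].
have ca := ce_compat_step fa ga.
by split=> //; apply: factors_step fa ca.
Qed.

End Constraint.

(** * Acyclicity over the constraint graph *)

Theorem rich_acyclic (E S : finType) (R : E -> rel S) (gT : finGroupType) (iota : E -> gT)
    (K N : nat) :
    is_Egraph R -> (forall e, iota e ^+ 2 = 1) -> compatible R iota ->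
    rich iota K #|E| -> (#|{: S * {set E}}| < K)%N -> (N <= K)%N ->
  N_acyclic R iota N.
Proof.
move=> HI inv Hc rG SK NK; split=> // n n2 nN g al s [_ [_ [conn sep]]].
case: n => // m in n2 nN g al s conn sep *.
have K0 : (0 < K)%N by apply: leq_ltn_trans SK.
(* Separation passes to plain cosets: a common point [x] factors the connecting walk at a vertex
   [p], and [g i * u] then lies in both constrained cosets. *)
have gsep i x : x \in g i *: gen iota (al i :&: al (ord_pred i)) ->
    x \in g (ordS i) *: gen iota (al i :&: al (ordS i)) -> False.
  rewrite !mem_lcoset => hx hy; have [w [hw ew]] := conn i.
  have e : ((g i)^-1 * x) * ((g (ordS i))^-1 * x)^-1 = wval iota w.
    by rewrite ew !invMg !invgK !mulgA mulgK mulVg mul1g.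
  have [] := factorsT HI inv Hc rG SK (subsetIl _ _) (subsetIl _ _) hx (gen_inv hy)
    (s := s i) (t := s (ordS i)).
    by rewrite e; exists w.
  move=> p [u [v [hu hv]]]; rewrite e => euv.
  apply: (sep i (g i * u)); split.
    by case: hu => uw [h ->]; exists uw; split=> //; exists p.
  case: hv => vw [h ev]; exists vw; split; first by exists p.
  by rewrite ew euv ev -mulgA mulgKV.
pose idx k : 'I_m.+1 := inord (k %% m.+1).
(* Indices are read modulo [m.+1], so the unrolled sequence satisfies the closing condition of
   [chain_open]. *)
have idxE k : idx k = (k %% m.+1)%N :> nat by rewrite inordK // ltn_mod.
have idxS k : idx k.+1 = ordS (idx k).
  by apply: val_inj; rewrite /= !idxE -addn1 -modnDml addn1.
have idxP k : idx k = ord_pred (idx k.+1) by rewrite idxS ordSK.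
have [|||||m1] := chain_open inv rG (m := m) (g := g \o idx) (a := al \o idx).
- exact: leq_trans nN NK.
- move=> i _ /=; rewrite idxS; have [w [[wa _] ->]] := conn (idx i).
  by rewrite mulKg; apply: wval_gen.
- move=> i x _ /= h1 h2; apply: (gsep (idx i.+1) x); last by rewrite -idxS.
  by rewrite -idxP setIC.
- exact: n2.
- by rewrite /= /idx modnn mod0n.
(* Only a cycle of length two is left; its point [g 0] lies trivially in one coset and by [h] in the
   other. *)
move=> /= h; apply: (gsep (idx 0%N) (g (idx 0%N))); last by rewrite -idxS.
by rewrite mem_lcoset mulVg gen_one.
Qed.

(** * Rich covers *)

Lemma wval_map (E : finType) (gT : finGroupType) (iota : E -> gT) (rho : E -> E) w :
  wval iota (map rho w) = wval (fun e => iota (rho e)) w.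
Proof. by rewrite /wval big_map. Qed.

Lemma run_restr (E V : finType) (f : E -> V -> V) (d : {set E}) w v :
  run (fun e => if e \in d then f e else id) w v = run f (restr d w) v.
Proof. by elim: w v => [|e w IH] v //=; rewrite -/(run _ w _) IH; case: ifP. Qed.

Lemma gen_card_le (E : finType) (gT hT : finGroupType) (iota : E -> gT) (kappa : E -> hT)
    (b : {set E}) :
    (forall e, iota e ^+ 2 = 1) -> (forall e, kappa e ^+ 2 = 1) ->
    (forall w, word_in b w -> wval iota w = 1 -> wval kappa w = 1) ->
  (#|gen kappa b| <= #|gen iota b|)%N.
Proof.
move=> inv invk kk.
have wP x : exists w, x \in gen iota b -> word_in b w /\ x = wval iota w.
  have [/gen_wordP [w wb ->]|] := boolP (x \in gen iota b); first by exists w.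
  by exists [::].
have [c cP] := boolp.choice wP.
apply: leq_trans (leq_imset_card (fun x => wval kappa (c x)) _); apply: subset_leq_card.
apply/subsetP => y /gen_wordP [w wb ->]; apply/imsetP; exists (wval iota w).
  exact: wval_gen.
have [cb e] := cP _ (wval_gen iota wb).
apply/eqP; rewrite eq_mulgV1 -(wval_rev invk) -wval_cat; apply/eqP/kk.
  by rewrite word_in_cat wb word_in_rev.
by rewrite wval_cat (wval_rev inv) -e mulgV.
Qed.

Lemma surj_bij (T : finType) (f : T -> T) : (forall y, exists x, f x = y) -> bijective f.
Proof.
move=> fs; have [g gK] := boolp.choice fs.
by apply: (bij_can_bij (injF_bij (can_inj gK))).
Qed.

(** The renaming extends to an endomorphism that reaches every generator, and a surjection of a
    finite set onto itself is bijective. *)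
Lemma word_symmetry (E : finType) (gT : finGroupType) (iota : E -> gT) (rho : {perm E}) :
    <<[set iota e | e : E]>> = [set: gT] -> (forall e, iota e ^+ 2 = 1) ->
    (forall w, wval iota w = 1 -> wval iota (map rho w) = 1) ->
  group_symmetry iota rho.
Proof.
move=> gG inv kk; have invr e : iota (rho e) ^+ 2 = 1 by apply: inv.
have [w /kk|f [fM fE]] := wval_compat_hom gG inv invr; first by rewrite wval_map.
exists f; split; [|split=> //].
  apply: surj_bij => y; have : y \in gen iota setT by rewrite gen_setT // inE.
  case/gen_wordP => w _ ->; exists (wval iota (map (rho^-1)%g w)).
  by rewrite fE -(wval_map iota rho) -map_comp (eq_map (permKV rho)) map_id.
by move=> e; have := fE [:: e]; rewrite !wval_cons !wval_nil !mulg1.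
Qed.

Lemma symmetry_word (E : finType) (gT : finGroupType) (iota : E -> gT) (rho : {perm E}) w :
  group_symmetry iota rho -> wval iota w = 1 -> wval iota (map rho w) = 1.
Proof.
case=> f [_ [fM fE]] w1.
have f1 : f 1 = 1 by apply: (mulgI (f 1)); rewrite -fM !mulg1.
rewrite -f1 -w1; elim: w {w1} => [|e w IH] /=; first by rewrite wval_nil f1.
by rewrite !wval_cons fM fE IH.
Qed.

(** Moving all actions of bounded size to one fixed ordinal makes them range over a finite type.
    Points outside the image of [D] are fixed. *)
Lemma perm_model (E V : finType) (f : E -> V -> V) (D : {set V}) (M : nat) :
    (forall e v, v \in D -> f e v \in D) ->
    (forall e v, v \in D -> f e (f e v) = v) -> (#|D| <= M.+1)%N ->
  exists (d : {ffun E -> {perm 'I_M.+1}}) (h : V -> 'I_M.+1),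
    [/\ forall e, d e ^+ 2 = 1, {in D &, injective h},
        forall w v, v \in D -> wval d w (h v) = h (run f w v)
      & forall w, (forall v, v \in D -> run f w v = v) -> wval d w = 1].
Proof.
move=> cl inv DM; pose h v : 'I_M.+1 := inord (index v (enum D)).
have hI : {in D &, injective h}.
  have hv w : w \in D -> (index w (enum D) < M.+1)%N.
    by move=> wD; apply: leq_trans DM; rewrite cardE index_mem mem_enum.
  move=> u v uD vD /(congr1 val); rewrite /= !inordK ?hv //.
  by move/index_inj => ->; rewrite ?mem_enum.
pose F e x := if [pick v in D | h v == x] is Some v then h (f e v) else x.
have Fh e v : v \in D -> F e (h v) = h (f e v).
  move=> vD; rewrite /F; case: pickP => [u /andP [uD /eqP /hI ->] //|/(_ v)].
  by rewrite /= vD eqxx.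
have FK e : involutive (F e).
  move=> x; case E1: [pick v in D | h v == x] => [v|].
    move: E1; case: pickP => // u /andP [uD /eqP <-] _.
    by rewrite !Fh ?inv //; apply: cl.
  by rewrite {2}/F E1 /F E1.
pose d := [ffun e => perm (inv_inj (FK e))]; exists d, h.
have dF w v : v \in D -> wval d w (h v) = h (run f w v).
  elim: w v => [|e w IH] v vD; first by rewrite wval_nil perm1.
  by rewrite wval_cons permM ffunE permE Fh // IH //; apply: cl.
split=> // [e|w wD]; apply/permP => x; rewrite perm1.
  by rewrite expgS expg1 permM ffunE !permE FK.
case E1: [pick v in D | h v == x] => [v|].
  move: E1; case: pickP => // u /andP [uD /eqP <-] _.
  by rewrite dF // wD.
elim: w {wD} => [|e w IH]; first by rewrite wval_nil perm1.
by rewrite wval_cons permM ffunE permE /F E1.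
Qed.

(** * Raising the level of richness by one *)

Section Step.
Variables (E : finType) (gT : finGroupType) (iota : E -> gT).
Hypothesis inv : forall e, iota e ^+ 2 = 1.
Variables (K j : nat).
Hypotheses (K0 : (0 < K)%N) (rG : rich iota K j).

(** The first summand bounds [K * sigma iota d] for every [d]; the second leaves room for the
    regular action of [gT]. *)
Let M := (K * (#|{set E}| * #|gT|) + #|gT|)%N.
Local Notation fam := {ffun E -> {perm 'I_M.+1}}.

Definition admissible (d : fam) : bool :=
  `[< (forall e, d e ^+ 2 = 1) /\ forall (b : {set E}) w, (#|b| <= j)%N -> word_in b w ->
        wval iota w = 1 -> wval d w = 1 >].

(** All admissible families act side by side, each on its own copy of the ordinal; the other copies
    are fixed. *)
Definition hat_fun (e : E) (p : fam * 'I_M.+1) : fam * 'I_M.+1 :=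
  if admissible p.1 then (p.1, p.1 e p.2) else p.

Lemma hat_inj e : injective (hat_fun e).
Proof.
move=> [d x] [d' x']; rewrite /hat_fun /=.
case: ifP => h; case: ifP => h' => // -[e1]; subst d'.
- by move/perm_inj => ->.
- by rewrite h in h'.
by rewrite h in h'.
Qed.

Definition hat e : {perm fam * 'I_M.+1} := perm (@hat_inj e).

Lemma hat_run w p : wval hat w p = if admissible p.1 then (p.1, wval p.1 w p.2) else p.
Proof.
elim: w p => [|e w IH] [d x]; first by rewrite !wval_nil !perm1; case: ifP.
by rewrite !wval_cons !permM IH permE /hat_fun /=; case h: (admissible d); rewrite /= h ?permM.
Qed.

Lemma hat_kerP w : wval hat w = 1 <-> forall d, admissible d -> wval d w = 1.
Proof.
split=> [w1 d ad|h].
  apply/permP => x; have := hat_run w (d, x); rewrite w1 !perm1 /= ad.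
  by case.
by apply/permP => -[d x]; rewrite hat_run perm1 /=; case: ifP => // /h ->; rewrite perm1.
Qed.

Lemma hat_inv e : hat e ^+ 2 = 1.
Proof.
have := hat_kerP [:: e; e]; rewrite !wval_cons wval_nil mulg1 => -[_ h].
apply: h => d /asboolP [h _]; by rewrite !wval_cons wval_nil mulg1; apply: h.
Qed.

Lemma hat_level (b : {set E}) w : (#|b| <= j)%N -> word_in b w ->
  wval iota w = 1 -> wval hat w = 1.
Proof. by move=> bj bw w1; apply/hat_kerP => d /asboolP [_]; apply; eassumption. Qed.

(** The regular action of [gT] is among the admissible families. *)
Lemma hat_ker w : wval hat w = 1 -> wval iota w = 1.
Proof.
move/hat_kerP => w1; pose f e (x : gT) := x * iota e.
have runE u x : run f u x = x * wval iota u.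
  elim: u x => [|e u IH] x /=; first by rewrite wval_nil mulg1.
  by rewrite -/(run f u _) IH wval_cons mulgA.
have [|||d [h [d2 hI dh d1]]] := @perm_model E gT f setT M.
- by move=> *; rewrite inE.
- by move=> e v _; rewrite /f -mulgA iotaK // mulg1.
- by rewrite cardsT ltnW // ltnS leq_addl.
have ad : admissible d.
  by apply/asboolP; split=> // b u bj bu u1; apply: d1 => v _; rewrite runE u1 mulg1.
have := dh w 1 (in_setT _); rewrite w1 // perm1 runE mul1g => /hI <- //.
Qed.

Lemma hat_sigma (d : {set E}) : (#|d| <= j.+1)%N -> (sigma hat d <= sigma iota d)%N.
Proof.
move=> dj; apply: leq_sum => b bd; apply: gen_card_le inv hat_inv _ => w.
by apply: hat_level; rewrite -ltnS; apply: leq_trans (proper_card bd) dj.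
Qed.

Lemma sigma_bound (d : {set E}) : (sigma iota d <= #|{set E}| * #|gT|)%N.
Proof.
rewrite /sigma; apply: leq_trans (_ : (\sum_(b : {set E} | b \proper d) #|gT|) <= _)%N.
  by apply: leq_sum => b _; apply: max_card.
by rewrite sum_nat_const leq_mul2r max_card orbT.
Qed.

(** Up to size [j] richness of [iota] suffices. At size [j.+1] the given action, with letters
    outside [d] made trivial, is itself admissible, so the kernel of [hat] acts trivially on it. *)
Lemma hat_rich : rich hat K j.+1.
Proof.
move=> d dj V f D cl finv DK sub w dw w1 v vD.
have subi (b : {set E}) : b \proper d -> compat_on iota f D b.
  move=> bd u bu u1; apply: (sub b bd) => //.
  have bj : (#|b| <= j)%N by rewrite -ltnS; apply: leq_trans (proper_card bd) dj.
  exact: hat_level bj bu u1.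
have DKi : (#|D| <= K * sigma iota d)%N.
  by apply: leq_trans DK _; rewrite leq_mul2l hat_sigma ?orbT.
have [dj'|jd] := leqP #|d| j.
  exact: (rG dj' cl finv DKi subi) dw (hat_ker w1) _ vD.
pose f' e := if e \in d then f e else id.
have [|||m [h [m2 hI mh m1]]] := @perm_model E V f' D M.
- by move=> e u uD; rewrite /f'; case: ifP => // ed; apply: cl.
- by move=> e u uD; rewrite /f'; case: ifP => // ed; apply: finv.
- apply: leq_trans DKi _; rewrite ltnW // ltnS; apply: leq_trans (leq_addr _ _).
  by rewrite leq_mul2l sigma_bound orbT.
(* A set [b] of size at most [j] cannot contain [d], so only the proper subset [d :&: b] acts, and
   [wval_restr] keeps the value 1 after deletion of the other letters. *)
have am : admissible m.
  apply/asboolP; split=> // b u bj bu u1; apply: m1 => x xD; rewrite /f' run_restr.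
  have db : d :&: b \proper d.
    by apply: setI_properl; apply/negP => /subset_leq_card; rewrite leqNgt (leq_ltn_trans bj).
  apply: (subi _ db) => //; first by rewrite word_inI word_in_filter word_in_restr.
  exact: (wval_restr inv K0 rG d bj bu u1).
have /(congr1 (fun s : {perm _} => s (h v))) := (hat_kerP w).1 w1 m am.
rewrite mh // perm1 /f' run_restr restr_id // => /hI -> //.
exact: (run_closed cl).
Qed.

(** Renaming by [rho] permutes the admissible families, since it preserves sizes of letter sets and
    relations of [iota]. *)
Lemma hat_symmetry (rho : {perm E}) w : group_symmetry iota rho ->
  wval hat w = 1 -> wval hat (map rho w) = 1.
Proof.
move=> sr /hat_kerP w1; apply/hat_kerP => d /asboolP [d2 dk].
pose d' : fam := [ffun e => d (rho e)].
have dE u : wval d' u = wval d (map rho u).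
  by rewrite wval_map /wval; apply: eq_bigr => e _; rewrite ffunE.
rewrite -dE; apply: w1; apply/asboolP; split=> [e|b u bj bu u1]; first by rewrite ffunE.
rewrite dE; apply: (dk (rho @: b)).
- by rewrite card_imset //; apply: perm_inj.
- by rewrite /word_in all_map; apply: sub_all bu => e eb; apply: imset_f.
exact: symmetry_word.
Qed.

Theorem rich_step : exists (hT : finGroupType) (iotah : E -> hT),
  [/\ <<[set iotah e | e : E]>> = [set: hT], forall e, iotah e ^+ 2 = 1,
      forall w, wval iotah w = 1 -> wval iota w = 1, rich iotah K j.+1 &
      forall rho : {perm E}, group_symmetry iota rho -> group_symmetry iotah rho].
Proof.
(* The letters must generate, so the cover is the subgroup generated by the [hat e], taken as a
   group type. *)
pose H : {group {perm fam * 'I_M.+1}} := <<[set hat e | e : E]>>%G.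
have hH e : hat e \in H by apply: mem_gen; apply: imset_f.
pose k e : subg_of H := subg H (hat e).
have kE w : sgval (wval k w) = wval hat w.
  elim: w => [|e w IH]; first by rewrite !wval_nil.
  by rewrite !wval_cons -IH /= subgK.
have k1 w : wval k w = 1 <-> wval hat w = 1.
  by rewrite -kE; split=> [->|h] //; apply: val_inj; rewrite /= h.
have k2 e : k e ^+ 2 = 1.
  have := (k1 [:: e; e]).2; rewrite !wval_cons !wval_nil !mulg1; apply; exact: hat_inv.
have kG : <<[set k e | e : E]>> = [set: subg_of H].
  apply/setP => x; rewrite inE.
  have : sgval x \in gen hat setT.
    have := subgP x; rewrite /gen; congr (_ \in <<_>>).
    by apply/setP => y; apply/imsetP/imsetP => -[e _ ->]; exists e.
  case/gen_wordP => w _ ew; have -> : x = wval k w by apply: val_inj; rewrite /= ew kE.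
  elim: w {ew} => [|e w IH]; first by rewrite wval_nil group1.
  by rewrite wval_cons groupM // mem_gen // imset_f.
exists (subg_of H), k; split=> //.
- by move=> w /k1; apply: hat_ker.
- move=> d dj V f D cl finv DK sub.
  have sg : sigma k d = sigma hat d.
    apply: eq_bigr => b _; apply/eqP; rewrite eqn_leq.
    by rewrite !gen_card_le //; try exact: hat_inv; move=> w _ /k1.
  move=> w dw /k1 w1; apply: (hat_rich dj cl finv) w1; rewrite -?sg //.
  by move=> b bd u bu /k1; apply: (sub b bd).
move=> rho sr; apply: word_symmetry => // w /k1 /(hat_symmetry sr).
by move/k1.
Qed.

End Step.

Theorem rich_cover (E : finType) (gT : finGroupType) (iota : E -> gT) (K n : nat) :
    <<[set iota e | e : E]>> = [set: gT] -> (forall e, iota e ^+ 2 = 1) -> (0 < K)%N ->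
  exists (hT : finGroupType) (iotah : E -> hT),
  [/\ <<[set iotah e | e : E]>> = [set: hT], forall e, iotah e ^+ 2 = 1,
      forall w, wval iotah w = 1 -> wval iota w = 1, rich iotah K n &
      forall rho : {perm E}, group_symmetry iota rho -> group_symmetry iotah rho].
Proof.
move=> gG inv K0; elim: n => [|n [hT [k [kG k2 kk kr ks]]]].
  (* At level 0 only the empty word occurs. *)
  exists gT, iota; split=> // d; rewrite leqn0 cards_eq0 => /eqP -> V f D _ _ _ _ w.
  by case: w => [|e w] //=; rewrite inE.
have [h2T [k' [kG' k2' kk' kr' ks']]] := rich_step k2 K0 kr.
exists h2T, k'; split=> //; first by move=> w /kk' /kk.
by move=> rho /ks /ks'.
Qed.

(** * The cover required by the theorem *)

Theorem mainTheorem2 (E S : finType) (R : E -> rel S) (HI : is_Egraph R)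
    (gT : finGroupType) (iota : E -> gT) (HG : is_Egroup iota)
    (Hcomp : compatible R iota) (N : nat) (HN : 2 <= N) :
  exists (hT : finGroupType) (iotah : E -> hT),
    is_Egroup iotah /\
    Egroup_succeq iotah iota /\
    N_acyclic R iotah N /\
    (forall rho : {perm E},
        graph_symmetry R rho -> group_symmetry iota rho -> group_symmetry iotah rho).
Proof.
case: HG => iI [gG [i1 i2]].
(* [K] must exceed the number of pieces of a coset extension and be at least the length of the
   cycles to exclude. *)
pose K := (#|{: S * {set E}}| + N).+1.
have [hT [k [kG k2 kk kr ks]]] := @rich_cover E gT iota K #|E| gG i2 isT.
have [f [fM fE]] := wval_compat_hom kG k2 i2 kk.
have fk e : f (k e) = iota e by have := fE [:: e]; rewrite !wval_cons !wval_nil !mulg1.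
have f1 : f 1 = 1 by have := fE [::]; rewrite !wval_nil.
exists hT, k; split; [|split; [|split]].
- split; [|split=> //; split=> // e].
    by move=> e e' /(congr1 f); rewrite !fk; apply: iI.
  by apply: contra_neq (i1 e) => ke; rewrite -fk ke f1.
- by exists f.
- apply: rich_acyclic kr _ _ => //.
  + by move=> w /kk; apply: Hcomp.
  + by rewrite ltnS leq_addr.
  by rewrite ltnW // ltnS leq_addl.
by move=> rho _; apply: ks.
Qed.
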